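(* Let $m$ be an even positive integer, $n$ a positive integer, and let $\mathcal{C}$ be an order $m$ dimension $n$ symmetric Cauchy tensor with generating vector $c=(c_1,\ldots,c_n)\in\mathbb{R}^n$. Then $\mathcal{C}$ is positive definite if and only if $c_1,\ldots,c_n$ are positive and mutually distinct.
   Context: $[n]=\{1,\ldots,n\}$. An order $m$ dimension $n$ symmetric Cauchy tensor with generating vector $c=(c_1,\ldots,c_n)\in\mathbb{R}^n$ is the real tensor $\mathcal{C}=(c_{i_1\cdots i_m})$ with entries $c_{i_1i_2\cdots i_m}=\frac{1}{c_{i_1}+c_{i_2}+\cdots+c_{i_m}}$, $i_1,\ldots,i_m\in[n]$, where it is assumed that $c_{i_1}+\cdots+c_{i_m}\neq 0$ for all $i_1,\ldots,i_m\in[n]$ (so in particular all $c_i\ne 0$). An order $m$ dimension $n$ tensor $\mathcal{A}=(a_{i_1\cdots i_m})$ is positive definite if $\mathcal{A}x^m:=\sum_{i_1,\ldots,i_m\in[n]}a_{i_1\cdots i_m}x_{i_1}\cdots x_{i_m}> 0$ for all nonzero $x\in\mathbb{R}^n$. *)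

(* Defs.v *)
From HB Require Import structures.
From mathcomp Require Import all_boot all_order all_algebra.
From mathcomp Require Import reals.

Set Implicit Arguments.
Unset Strict Implicit.
Unset Printing Implicit Defensive.

Import Order.TTheory GRing.Theory Num.Theory.
Local Open Scope ring_scope.

(* The multi-index (i_1, ..., i_m) is a finite function 'I_m -> 'I_n. *)
Definition tensor (R : Type) (m n : nat) := {ffun 'I_m -> 'I_n} -> R.

(* The value A x^m of the degree m form attached to A. *)
Definition tensor_form (R : realType) (m n : nat)
    (A : tensor R m n) (x : 'rV[R]_n) : R :=
  \sum_(i : {ffun 'I_m -> 'I_n}) A i * \prod_(k < m) x 0 (i k).

Definition positive_definite (R : realType) (m n : nat)
    (A : tensor R m n) : Prop :=
  forall x : 'rV[R]_n, x != 0 -> 0 < tensor_form A x.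

(* The first clause is needed because 0^-1 = 0 in MathComp. *)
Definition cauchy_tensor (R : realType) (m n : nat)
    (c : 'rV[R]_n) (A : tensor R m n) : Prop :=
  (forall i : {ffun 'I_m -> 'I_n}, \sum_(k < m) c 0 (i k) != 0) /\
  (forall i : {ffun 'I_m -> 'I_n}, A i = (\sum_(k < m) c 0 (i k))^-1).

(* Main.v *)
(** Sufficiency is the positivity of the integral over s > 0 of g(s)^m, where
    g(s) = sum_j x_j exp(-c_j s), which equals C x^m.  Integration is avoided by
    using the explicit antiderivative: G(s), obtained by weighting each term
    C_I x_I of C x^m by exp(-c_I s) with c_I = c_(i_1) + ... + c_(i_m), satisfies
    G(0) = C x^m, G' = -g^m <= 0 and G -> 0 at infinity.  If G(0) <= 0, then G
    vanishes on the half-line, hence so does g, contradicting the linear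
    independence of exponentials with distinct rates.  Necessity is tested on e_i
    and on e_i - e_j. *)

Require Import Defs.
From HB Require Import structures.
From mathcomp Require Import all_boot all_order all_algebra.
From mathcomp Require Import reals.
From mathcomp Require Import boolp functions topology normedtype.
From mathcomp Require Import sequences derive realfun exp ring.

Set Implicit Arguments.
Unset Strict Implicit.
Unset Printing Implicit Defensive.

Import Order.TTheory GRing.Theory Num.Theory.
Import numFieldNormedType.Exports.
Local Open Scope classical_set_scope.
Local Open Scope ring_scope.

Section ExponentialSums.
Variable R : realType.

(** The index type is arbitrary because g is indexed by ['I_n] and G by multi-indices. *)
Definition expsum (J : finType) (a l : J -> R) (s : R) : R :=
  \sum_j a j * expR (- (l j * s)).

Lemma expsum0 (J : finType) (a l : J -> R) : expsum a l 0 = \sum_j a j.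
Proof. by apply: eq_bigr => j _; rewrite mulr0 oppr0 expR0 mulr1. Qed.

Lemma is_derive_expsum (J : finType) (a l : J -> R) (s : R) :
  is_derive s 1 (expsum a l) (expsum (fun j => - (l j * a j)) l s).
Proof.
pose h (i : 'I_#|J|) (t : R) : R :=
  a (enum_val i) * expR (- (l (enum_val i) * t)).
have -> : expsum a l = \sum_(i < #|J|) h i.
  by apply/funext => t; rewrite fct_sumE /expsum big_enum_val.
rewrite [X in is_derive _ _ _ X]/expsum.
rewrite [X in is_derive _ _ _ X]big_enum_val.
apply: is_derive_sum => i.
set b := a _; set d := l _.
have dlin : is_derive s 1 (fun t : R => - (d * t)) (- d).
  have := @is_deriveN _ _ _ _ _ _ _
    (@is_deriveZ _ _ _ _ d _ _ _ (is_derive_id s (1 : R))).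
  by rewrite [_ *: _]mulr1.
have := @is_deriveZ _ _ _ _ b _ _ _
  (@is_derive1_comp _ expR _ _ _ _ (is_derive_expR _) dlin).
by rewrite /GRing.scale /= => /is_derive_eq; apply; ring.
Qed.

(** Along the integers each term is a geometric sequence of ratio [expR (- l j)] < 1; monotonicity
    of G will extend the information to real arguments. *)
Lemma cvgn_expsum (J : finType) (a l : J -> R) :
  (forall j, 0 < l j) -> expsum a l k%:R @[k --> \oo] --> (0 : R).
Proof.
move=> l_gt0; have <- : \sum_(j : J) (0 : R) = 0 by rewrite big1.
apply: cvg_big => [|j _]; first exact: add_continuous.
rewrite -[X in _ --> X](mulr0 (a j)); apply: cvgMr.
have -> : (fun k : nat => expR (- (l j * k%:R))) = GRing.exp (expR (- l j)).
  by apply/funext => k; rewrite -expRM_natl mulrN mulrC.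
by apply: cvg_expr; rewrite ger0_norm ?expR_ge0// expR_lt1 oppr_lt0.
Qed.

Lemma expsum_exp (J : finType) (a l : J -> R) (m : nat) (s : R) :
  expsum a l s ^+ m =
  expsum (fun f : {ffun 'I_m -> J} => \prod_k a (f k))
         (fun f : {ffun 'I_m -> J} => \sum_k l (f k)) s.
Proof.
rewrite -[in LHS](card_ord m) -prodr_const bigA_distr_bigA.
apply: eq_bigr => f _.
by rewrite big_split mulr_suml -sumrN expR_sum.
Qed.

(* At the points 1, ..., n the sum is a Vandermonde system with nodes
   [expR (- l j)]. *)
Lemma expsum_neq0 (n : nat) (a l : 'I_n -> R) :
  injective l -> (exists j, a j != 0) -> exists k, expsum a l k.+1%:R != 0.
Proof.
move=> l_inj [j aj]; apply/not_existsP => all0.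
pose q : 'rV[R]_n := \row_j expR (- l j).
suff: \det (Vandermonde n q)^T == 0.
  rewrite det_tr det_Vandermonde => /prodf_eq0[i _ /prodf_eq0[i' lt_ii']].
  rewrite !mxE subr_eq0 => /eqP/expR_inj/oppr_inj/l_inj E.
  by rewrite E ltnn in lt_ii'.
(* Sampling starts at 1 but Vandermonde powers start at 0, so the kernel vector absorbs one factor
   [expR (- l j)]. *)
apply/det0P; exists (\row_j (a j * expR (- l j))).
  by apply/rV0Pn; exists j; rewrite mxE mulf_neq0 // gt_eqF ?expR_gt0.
apply/rowP => k; rewrite !mxE.
have /negP := all0 k; rewrite negbK => /eqP; apply: etrans.
apply: eq_bigr => i _; rewrite !mxE -mulrA -exprS -expRM_natl.
by rewrite mulrN [_ * l i]mulrC.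
Qed.

Lemma expsum_gt0_of_derive (J : finType) (a l : J -> R) (s : R) :
  (forall j, 0 < l j) ->
  (forall t, expsum (fun j => - (l j * a j)) l t <= 0) ->
  0 < s -> expsum (fun j => - (l j * a j)) l s != 0 -> 0 < \sum_j a j.
Proof.
move=> l_gt0 d_le0 s_gt0; apply: contra_neqT; rewrite -leNgt -(expsum0 a l).
set G := expsum a l => G0_le0.
have dG t : derivable G t 1 by have [] := is_derive_expsum a l t.
have G_nincr x y : 0 <= x -> x <= y -> G y <= G x.
  apply: ler0_derive1_nincry => [//|t _|].
    by rewrite derive1E (@derive_val _ _ _ _ _ _ _ (is_derive_expsum a l t)).
  exact: derivable_within_continuous.
have G_ge0 x : 0 <= x -> 0 <= G x.
  move=> x_ge0; have cG := cvgn_expsum a l_gt0.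
  rewrite -(cvg_lim (@Rhausdorff R) cG); apply: limr_le; first exact: cvgP cG.
  near=> k; apply: G_nincr => //; near: k; exact: nbhs_infty_ger.
have G_eq0 x : 0 <= x -> G x = 0.
  move=> x_ge0; apply/eqP; rewrite eq_le G_ge0 // andbT.
  exact: le_trans (G_nincr _ _ _ x_ge0) G0_le0.
have G'0 : is_derive s 1 G 0.
  (* G vanishes on this interval, so its interior point [s] is a maximum; [s + 1] is just some bound
     beyond [s]. *)
  apply: (@derive1_at_max _ G 0 (s + 1)) => //.
  - by rewrite addr_ge0 // ltW.
  - by rewrite in_itv /= s_gt0 ltrDl ltr01.
  - by move=> t /[!in_itv] /= /andP[/ltW t_ge0 _]; rewrite !G_eq0 // ltW.
by rewrite -(@derive_val _ _ _ _ _ _ _ (is_derive_expsum a l s)) derive_val.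
Unshelve. all: by end_near. Qed.

End ExponentialSums.

Section Cauchy.
Variables (R : realType) (m n : nat) (c : 'rV[R]_n) (C : tensor R m n).
Hypothesis hC : cauchy_tensor c C.

(** Every multi-index contributing to the form has the same denominator, which factors out of the
    expanded power. Both test vectors for necessity are of this kind. *)
Lemma tensor_form_constant (x : 'rV[R]_n) (i0 : 'I_n) :
  (forall j, x 0 j != 0 -> c 0 j = c 0 i0) ->
  tensor_form C x = (m%:R * c 0 i0)^-1 * (\sum_j x 0 j) ^+ m.
Proof.
move=> supp; rewrite -[in RHS](card_ord m) -prodr_const bigA_distr_bigA.
rewrite card_ord mulr_sumr; apply: eq_bigr => f _.
have [/forallP nz|] := boolP [forall k, x 0 (f k) != 0]; last first.
  rewrite negb_forall => /existsP[k /negPn/eqP xk].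
  by rewrite (bigD1 k) //= xk mul0r !mulr0.
rewrite hC.2 (eq_bigr (fun=> c 0 i0)) => [|k _]; last exact: supp.
by rewrite sumr_const card_ord mulr_natl.
Qed.

Lemma cauchy_tensor_form_gt0 (x : 'rV[R]_n) :
  ~~ odd m -> (forall i, 0 < c 0 i) -> injective (c 0) ->
  x != 0 -> 0 < tensor_form C x.
Proof.
move=> m_even c_gt0 c_inj /rV0Pn x_neq0.
pose l (f : {ffun 'I_m -> 'I_n}) := \sum_k c 0 (f k).
(* Differentiation brings down [l f], which cancels [C f], its inverse. *)
have dE t : expsum (fun f => - (l f * (C f * \prod_k x 0 (f k)))) l t =
            - expsum (x 0) (c 0) t ^+ m.
  rewrite expsum_exp -sumrN; apply: eq_bigr => f _.
  rewrite mulNr; congr (- (_ * _)).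
  by rewrite mulrA hC.2 mulfV ?mul1r //; apply: hC.1.
have [k gk] := expsum_neq0 c_inj x_neq0.
apply: (@expsum_gt0_of_derive _ _ _ l k.+1%:R) => //.
(* Strictness comes from the nonvanishing of the Cauchy denominators. *)
- by move=> f; rewrite lt_def hC.1 sumr_ge0 // => k' _; apply: ltW.
- by move=> t; rewrite dE oppr_le0 exprn_even_ge0.
- by rewrite dE oppr_eq0 expf_neq0.
Qed.

(** At e_i the form equals 1/(m c_i). *)
Lemma positive_definite_cauchy_gt0 :
  (0 < m)%N -> positive_definite C -> forall i, 0 < c 0 i.
Proof.
move=> m_gt0 pdC i.
have /pdC : delta_mx 0 i != 0 :> 'rV[R]_n.
  by apply/rV0Pn; exists i; rewrite mxE !eqxx oner_eq0.
rewrite (@tensor_form_constant _ i) => [|j]; last first.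
  by rewrite mxE eqxx /=; have [->|] := eqVneq j i; rewrite ?eqxx.
rewrite (bigD1 i) //= big1 => [|j ji]; last by rewrite mxE (negPf ji).
by rewrite mxE !eqxx addr0 expr1n mulr1 invr_gt0 pmulr_rgt0 ?ltr0n.
Qed.

(** If c_i = c_j, the form at e_i - e_j is a multiple of 0^m, which is 0 because m > 0. *)
Lemma positive_definite_cauchy_inj :
  (0 < m)%N -> positive_definite C ->
  forall i j, i != j -> c 0 i != c 0 j.
Proof.
move=> m_gt0 pdC i j ij; apply/eqP => cij.
pose x : 'rV[R]_n := delta_mx 0 i - delta_mx 0 j.
have /pdC : x != 0.
  apply/rV0Pn; exists i.
  by rewrite !mxE !eqxx (negPf ij) subr0 oner_eq0.
rewrite (@tensor_form_constant _ i) => [|k]; last first.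
  rewrite !mxE eqxx /=; have [->//|_] := eqVneq k i.
  by have [->//|_] := eqVneq k j; rewrite subr0 eqxx.
rewrite (bigD1 i) // (bigD1 j) 1?eq_sym //= big1 => [|k /andP[ki kj]].
  rewrite !mxE !eqxx (negPf ij) eq_sym (negPf ij) subr0 sub0r addr0 subrr.
  by rewrite expr0n gtn_eqF // mulr0 ltxx.
by rewrite !mxE (negPf ki) (negPf kj) subr0.
Qed.

End Cauchy.

Theorem theorem2p3 (R : realType) (m n : nat)
    (m_gt0 : (0 < m)%N) (m_even : ~~ odd m) (n_gt0 : (0 < n)%N)
    (c : 'rV[R]_n) (C : tensor R m n) (hC : cauchy_tensor c C) :
  positive_definite C <->
  (forall i : 'I_n, 0 < c 0 i) /\
  (forall i j : 'I_n, i != j -> c 0 i != c 0 j).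
Proof.
split=> [pdC|[c_gt0 c_neq] x].
  split; first exact: positive_definite_cauchy_gt0 pdC.
  exact: positive_definite_cauchy_inj pdC.
apply: (cauchy_tensor_form_gt0 hC) => // i j cij.
by apply: contra_eq cij; apply: c_neq.
Qed.
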